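(* Let $n\in\mathbb N$ with $n\neq 3$ and $n\equiv 0,2\pmod 3$. For every $\ell\in\{1,\dots,n\}$ there exists a multiset $\{\mathcal F_1,\dots,\mathcal F_{n^2}\}$ of splits of $\{1,\dots,\ell\}$ such that \begin{itemize} \item $\mu_i^1=n-\ell+1$ for all $i\in\{1,\dots,n^2\}$; \item $\mu_i^j=1$ for all $i\in\{1,\dots,n^2\}$ and $j\in\{2,\dots,\ell\}$; \item $\mu_S^r=a_S^r\binom{n-\ell+1}{r}$ for every $0\le r\le 3$ and every set $S\subseteq\{2,\dots,\ell\}$ with $0\le |S|\le 3-r$. \end{itemize}
   Context: For a multiset $A$ and an element $u$, $\mu_A(u)$ is the multiplicity of $u$ in $A$; $\{u^r\}$ denotes the multiset consisting of $r$ copies of $u$, and multiset union adds multiplicities. A split of $\{1,\dots,\ell\}$ is a multiset $\mathcal F$ of multisets such that each $A\in\mathcal F$ is of the form $\{1^r\}\cup S$ for some $0\le r\le 3$ and some set $S\subseteq\{2,\dots,\ell\}$ with $0\le|S|\le 3-r$. Given a multiset $\{\mathcal F_1,\dots,\mathcal F_{n^2}\}$ of splits of $\{1,\dots,\ell\}$: for $i\in\{1,\dots,n^2\}$ and $j\in\{1,\dots,\ell\}$, $\mu_i^j=\sum_{A\in\mathcal F_i}\mu_A(j)$ (sum over elements of $\mathcal F_i$ counted with multiplicity); for $0\le r\le 3$ and a set $S\subseteq\{2,\dots,\ell\}$ with $0\le|S|\le 3-r$, $\mu_S^r=\sum_{i=1}^{n^2}\mu_{\mathcal F_i}(S\cup\{1^r\})$,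 the total multiplicity of the multiset $S\cup\{1^r\}$ among the $\mathcal F_i$. Finally $a_S^r=0,1,3,2$ according as $r+|S|=0,1,2,3$ respectively. *)

(* Defs.v *)
From mathcomp Require Export all_boot finmap multiset.
Set Implicit Arguments.
Unset Strict Implicit.
Unset Printing Implicit Defensive.
Open Scope fset_scope.
Open Scope mset_scope.
Open Scope nat_scope.

(* For A : {mset T}, the multiplicity of u in A is the application A u, and
   iterating over A, as in \sum_(u <- A), repeats u exactly A u times. *)

Definition admissible (l r : nat) (S : {fset nat}) : Prop :=
  [/\ r <= 3, forall j : nat, j \in S -> 2 <= j <= l & #|` S| <= 3 - r].

(* The multiset {1^r} \cup S; the union of multisets adds multiplicities. *)
Definition ones_set (r : nat) (S : {fset nat}) : {mset nat} :=
  msetn r 1 `+` seq_mset S.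

Definition is_split (l : nat) (F : {mset {mset nat}}) : Prop :=
  forall A : {mset nat}, A \in F ->
    exists r S, admissible l r S /\ A = ones_set r S.

(* A multiset {F_1, ..., F_m} of splits is given by an indexing family over
   'I_m; the entries may be repeated. *)

Definition mu_elt (m : nat) (F : 'I_m -> {mset {mset nat}})
    (i : 'I_m) (j : nat) : nat :=
  \sum_(A <- F i) A j.

Definition mu_set (m : nat) (F : 'I_m -> {mset {mset nat}})
    (r : nat) (S : {fset nat}) : nat :=
  \sum_(i < m) F i (ones_set r S).

Definition a_coef (r : nat) (S : {fset nat}) : nat :=
  nth 0 [:: 0; 1; 3; 2] (r + #|` S|).

(* Main.v *)
(* Induction on l, obtaining the new point l + 1 by relabelling, in every split,
   exactly one copy of 1.  Writing m for the common multiplicity of 1 in the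
   splits, the required multiplicities say that a block {1^r} \cup S must be
   relabelled in exactly the fraction r / m of its occurrences; this fractional
   choice is rounded to an integral one by Hall's theorem, as in Baranyai's
   theorem.  The congruence on n is only needed to start the induction at l = 1,
   where splits are partitions of n into parts of size at most 3. *)
From mathcomp Require Import zify ring.
Require Import Defs.

Set Implicit Arguments.
Unset Strict Implicit.
Unset Printing Implicit Defensive.

(** * Hall's theorem with capacities, and integral rounding of weighted choices *)

Definition neighbours (I T : finType) (e : I -> T -> bool) (X : {set I}) :=
  [set t | [exists i in X, e i t]].

Lemma neighboursP (I T : finType) (e : I -> T -> bool) (X : {set I}) (t : T) :
  reflect (exists2 i, i \in X & e i t) (t \in neighbours e X).
Proof.
rewrite inE; apply: (iffP existsP) => [[i /andP[]]|[i iX eit]]; exists i => //.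
by rewrite iX.
Qed.

(* Halmos-Vaughan: either every nonempty proper subset of A has slack, and then
   any admissible choice for one element preserves Hall's condition, or some
   tight subset X splits the problem into X and A :\: X. *)
Lemma hall_capacity (I T : finType) (e : I -> T -> bool) (c : T -> nat)
    (t0 : T) (A : {set I}) :
  (forall X : {set I}, X \subset A -> #|X| <= \sum_(t in neighbours e X) c t) ->
  exists2 f : I -> T, forall i, i \in A -> e i (f i) &
    forall t, #|[set i in A | f i == t]| <= c t.
Proof.
have [k leAk] := ubnP #|A|; elim: k => // k IHk in c A leAk *; move=> hall.
have [->|[x xA]] := set_0Vmem A.
  exists (fun=> t0) => [i|t]; first by rewrite inE.
  by rewrite (_ : [set _ in _ | _] = set0) ?cards0 //; apply/setP=> i; rewrite !inE.
have cardA : #|A :\ x| < k by rewrite (cardsD1 x A) xA in leAk; lia.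
have [/existsP[X /and4P[X0 XA neXA tight]]|slack] := boolP [exists X : {set I},
    [&& X != set0, X \subset A, X != A & \sum_(t in neighbours e X) c t <= #|X|]].
- have cX : #|X| < #|A| by apply: proper_card; rewrite properEneq neXA.
  have [||f1 ef1 cf1] := IHk c X; first lia.
    by move=> Y YX; apply: hall; apply: subset_trans XA.
  (* Tightness means that [X] uses up the whole capacity of its neighbourhood, so nothing is left
     there for [A :\: X]. Hall's condition for [Y] is the one for [Y :|: X] minus the tight one. *)
  pose c' t := if t \in neighbours e X then 0 else c t.
  have [||f2 ef2 cf2] := IHk c' (A :\: X).
  + have := cardsD A X; rewrite (setIidPr XA).
    by move: X0; rewrite -card_gt0; lia.
  + move=> Y; rewrite subsetD => /andP[YA dYX].
    have := hall (Y :|: X); rewrite subUset YA XA => /(_ isT).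
    rewrite cardsU (disjoint_setI0 dYX) cards0 subn0.
    rewrite (bigID (fun t => t \in neighbours e X)) /=.
    rewrite (eq_bigl (fun t => t \in neighbours e X)) => [|t]; last first.
      apply/andP/idP => [[]//|tX]; split=> //; move/neighboursP: tX => [i iX eit].
      by apply/neighboursP; exists i => //; rewrite inE iX orbT.
    rewrite [X in _ -> _ <= X](_ : _ =
      \sum_(t in neighbours e (Y :|: X) | t \notin neighbours e X) c t).
      by lia.
    rewrite [RHS]big_mkcond /= [LHS]big_mkcond /=; apply: eq_bigr => t _.
    rewrite /c'; case: (boolP (t \in neighbours e X)) => [_|tX].
      by rewrite andbF if_same.
    rewrite andbT; congr (if _ then _ else _).
    apply/neighboursP/neighboursP => [[i iY]|[i]].
      by exists i => //; rewrite inE iY.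
    rewrite inE => /orP[iY|iX] eit; first by exists i.
    by case/neighboursP: tX; exists i.
  exists (fun i => if i \in X then f1 i else f2 i) => [i iA|t].
    by case: ifP => iX; [apply: ef1|apply: ef2; rewrite inE iX].
  have [tX|tX] := boolP (t \in neighbours e X).
    apply: leq_trans (cf1 t); apply/subset_leq_card/subsetP => i.
    rewrite !inE => /andP[iA]; case: ifP => // iX fi.
    have := cf2 t; rewrite /c' tX leqn0 cards_eq0 => /eqP/setP/(_ i).
    by rewrite !inE iX iA fi.
  have := cf2 t; rewrite /c' (negPf tX); apply: leq_trans.
  apply/subset_leq_card/subsetP => i.
  rewrite !inE => /andP[iA]; case: ifP => // [iX /eqP fi|_ ->]; last by rewrite iA.
  by case/neighboursP: tX; exists i => //; rewrite -fi ef1.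
have [t tx ct] : exists2 t, e x t & 0 < c t.
  have := hall [set x]; rewrite sub1set xA cards1 => /(_ isT).
  rewrite lt0n sum_nat_eq0 negb_forall => /existsP[t].
  rewrite negb_imply -lt0n => /andP[/neighboursP[y /set1P-> eyt] ct].
  by exists t.
pose c' u := c u - (u == t).
have [//|Y YA|f ef cf] := IHk c' (A :\ x).
  have [->|Y0] := eqVneq Y set0; first by rewrite cards0.
  have YA' : Y \subset A := subset_trans YA (subsetDl _ _).
  have neYA : Y != A.
    by apply: contraL YA => /eqP->; apply/subsetPn; exists x; rewrite ?inE ?eqxx.
  move: slack; rewrite negb_exists => /forallP/(_ Y).
  rewrite Y0 YA' neYA /= -ltnNge => slackY.
  (* Reserving one unit at [t] costs [Y] at most one unit of capacity, which the strict slack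
     covers. *)
  have : \sum_(u in neighbours e Y) c u <=
         \sum_(u in neighbours e Y) c' u + \sum_u (u == t).
    rewrite [X in _ + X](bigID (fun u => u \in neighbours e Y)) /= addnA -big_split /=.
    by apply: leq_trans (leq_addr _ _); apply: leq_sum => u _; rewrite /c'; lia.
  have -> : \sum_u (u == t) = 1 by rewrite (bigD1 t) //= eqxx big1 // => u /negPf->.
  by lia.
exists (fun i => if i == x then t else f i) => [i iA|u].
  by case: eqP => [->//|/eqP ix]; apply: ef; rewrite !inE ix.
have [ut|ut] := eqVneq u t.
  have := cf t; rewrite /c' eqxx ut => cft.
  rewrite (cardsD1 x) !inE xA !eqxx /=.
  have -> : [set i in A | (if i == x then t else f i) == t] :\ x =
      [set i in A :\ x | f i == t].
    by apply/setP=> i; rewrite !inE; case: eqP.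
  by lia.
have := cf u; rewrite /c' (negPf ut) subn0; apply: leq_trans.
apply/subset_leq_card/subsetP => i; rewrite !inE.
by case: (eqVneq i x) => // _; rewrite eq_sym (negPf ut) andbF.
Qed.

(* Weighted form of a transportation problem: the fractional solution
   [G i A * w A / m] has integral column sums [c A], and Hall's theorem rounds it. *)
Lemma balanced_choice (I : finType) (K : choiceType) (G : I -> {mset K})
    (w c : K -> nat) (m : nat) :
  0 < m -> (forall i, \sum_(A <- G i) w A = m) ->
  (forall A, w A * \sum_i G i A = m * c A) ->
  exists f : I -> K, (forall i, (f i \in G i) /\ 0 < w (f i)) /\
    forall A, #|[set i | f i == A]| = c A.
Proof.
move=> m0 rowG colG.
case: (pickP I) => [i0 _|I0]; last first.
  exists (fun i => False_rect K (Bool.diff_true_false (I0 i))); split=> [i|A].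
    by have := I0 i.
  have := colG A; rewrite big_pred0 // muln0 => /esym/eqP.
  rewrite muln_eq0 -[m == 0]negbK -lt0n m0 /= => /eqP->.
  by apply/eqP; rewrite cards_eq0; apply/eqP/setP => i; have := I0 i.
(* All supports together form a finite type of targets, as Hall's theorem requires. *)
pose D : {fset K} := \bigcup_(i <- enum I) finsupp (G i).
have memD i A : A \in G i -> A \in D.
  by move=> AG; apply/bigfcupP; exists i; rewrite ?mem_enum // msuppE.
have rowD i : \sum_(t : D) G i (val t) * w (val t) = m.
  rewrite -(rowG i) sum_mset -(big_seq_fsetE _ _ predT (fun A => G i A * w A)) /=.
  apply/esym/big_fset_incl => [|A _]; last by rewrite memNfinsupp => /eqP->.
  by apply/fsubsetP => A; rewrite msuppE; apply: memD.
pose e i (t : D) := (val t \in G i) && (0 < w (val t)).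
have [t0 _] : exists t : D, true.
  have := rowD i0; case: (pickP D) => [t _ _|D0]; first by exists t.
  by rewrite big_pred0 // => /esym/eqP; rewrite -[_ == 0]negbK -lt0n m0.
(* Double counting of the total weight [m * #|I|]. Since the capacities sum to exactly [#|I|], every
   bound given by Hall's theorem will turn out to be an equality. *)
have total : \sum_(t : D) c (val t) = #|I|.
  apply/eqP; rewrite -(eqn_pmul2l m0) big_distrr /=; apply/eqP.
  under eq_bigr => t _ do rewrite -colG big_distrr /=.
  rewrite exchange_big /= mulnC -sum_nat_const; apply: eq_bigr => i _.
  by rewrite -(rowD i); apply: eq_bigr => t _; rewrite mulnC.
have [X _|f ef cf] := @hall_capacity I D e (fun t => c (val t)) t0 setT.
  rewrite -(leq_pmul2l m0) big_distrr /=.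
  under [leqRHS]eq_bigr => t _ do rewrite -colG big_distrr /=.
  rewrite exchange_big /= mulnC -sum_nat_const.
  (* Each [i] in [X] has its entire weight [m] on neighbours of [X]. *)
  apply: (@leq_trans (\sum_(i in X) \sum_(t in neighbours e X) w (val t) * G i (val t))).
    apply: leq_sum => i iX; rewrite -{1}(rowD i) [leqRHS]big_mkcond /=.
    apply: leq_sum => t _; case: ifPn => [_|tX]; first by rewrite mulnC.
    rewrite leqn0 muln_eq0 mset_eq0 -[w _ == 0]negbK -lt0n -negb_and.
    by apply: contra tX => eit; apply/neighboursP; exists i.
  by rewrite [leqRHS](bigID (fun i => i \in X)) /= leq_addr.
exists (fun i => val (f i)); split=> [i|A].
  by have /andP[] := ef i (in_setT _).
have [AD|AD] := boolP (A \in D); last first.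
  have -> : [set i | val (f i) == A] = set0.
    by apply/setP=> i; rewrite !inE; apply: contraNF AD => /eqP <-; apply: valP.
  have := colG A; rewrite big1 => [|i _]; last first.
    by apply/eqP; rewrite mset_eq0; apply: contra AD; apply: memD.
  by rewrite muln0 cards0; nia.
have eq_count (t : D) : #|[set i in setT | f i == t]| = c (val t).
  have /leqif_sum : forall u : D, true -> #|[set i in setT | f i == u]| <= c (val u)
      ?= iff (#|[set i in setT | f i == u]| == c (val u)) by move=> u _; split.
  case=> _; rewrite total -[X in _ == X]cardsT.
  rewrite -sum1_card (partition_big f predT) //=.
  under [X in _ == X]eq_bigr => u _ do rewrite sum1_card.
  under [X in X == _]eq_bigr => u _ do rewrite cardsE.
  by rewrite eqxx => /esym/forallP/(_ t)/eqP.
rewrite -(eq_count [` AD]); apply: eq_card => i; rewrite !inE /=.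
by rewrite -val_eqE.
Qed.

(** * Sums over multisets and multiplicities in blocks *)

Lemma sum_msetD (K : choiceType) (A B : {mset K}) (h : K -> nat) :
  \sum_(x <- A `+` B) h x = \sum_(x <- A) h x + \sum_(x <- B) h x.
Proof.
rewrite -big_cat; apply: perm_big; apply/allP => x _ /=.
by rewrite count_cat !count_mem_mset msetE2.
Qed.

Lemma sum_msetn (K : choiceType) (k : nat) (a : K) (h : K -> nat) :
  \sum_(x <- msetn k a) h x = k * h a.
Proof. by rewrite big_msetn /= Monoid.iteropE iter_addn_0 mulnC. Qed.

Lemma ones_setE (r : nat) (S : {fset nat}) (j : nat) :
  ones_set r S j = (if j == 1 then r else 0) + (j \in S).
Proof. by rewrite msetE2 msetnE mset_seqE count_uniq_mem ?fset_uniq. Qed.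

Lemma admissible_notin (l r : nat) (S : {fset nat}) (j : nat) :
  admissible l r S -> ~~ (2 <= j <= l) -> j \in S = false.
Proof. by case=> _ lS _ jl; apply: contraNF jl => /lS. Qed.

Lemma ones_set_eq1 (l r : nat) (S : {fset nat}) :
  admissible l r S -> ones_set r S 1 = r.
Proof. by move=> /admissible_notin lS; rewrite ones_setE lS // addn0. Qed.

Lemma ones_set_gt (l r : nat) (S : {fset nat}) (j : nat) :
  0 < l -> l < j -> admissible l r S -> ones_set r S j = 0.
Proof.
move=> l0 lj /admissible_notin lS; rewrite ones_setE lS ?addn0; last by lia.
by case: eqP => //; lia.
Qed.

(** * The inductive step: relabelling one copy of 1 in every split *)

Definition split_family (n l : nat) (F : 'I_(n ^ 2) -> {mset {mset nat}}) :=
  [/\ forall i, is_split l (F i),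
      forall i, mu_elt F i 1 = n - l + 1,
      forall i j, 2 <= j <= l -> mu_elt F i j = 1 &
      forall r S, admissible l r S ->
        mu_set F r S = a_coef r S * 'C(n - l + 1, r)].

Definition relabel_one (l : nat) (A : {mset nat}) : {mset nat} := l +` (A `\ 1).

Lemma relabel_oneE (l : nat) (A : {mset nat}) (j : nat) :
  relabel_one l A j = (j == l) + (A j - (j == 1)).
Proof. by rewrite mset1DE msetB1E. Qed.

(** Makes relabelling injective on multisets containing 1, so a relabelled block determines its
    origin. *)
Lemma relabel_oneK (l : nat) (A : {mset nat}) :
  0 < A 1 -> 1 +` (relabel_one l A `\ l) = A.
Proof. by move=> A1; rewrite msetD1K msetB1K // in_mset. Qed.

Lemma relabel_ones_set (l r : nat) (S : {fset nat}) :
  0 < l -> admissible l r.+1 S ->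
  relabel_one l.+1 (ones_set r.+1 S) = ones_set r (l.+1 |` S)%fset.
Proof.
move=> l0 adm; apply/msetP => j; rewrite relabel_oneE !ones_setE in_fset1U.
have S1 : 1 \in S = false by apply: admissible_notin adm _.
have Sl : l.+1 \in S = false by apply: admissible_notin adm _; lia.
have [->|j1] := eqVneq j 1; first by rewrite S1; lia.
by have [->|_] := eqVneq j l.+1; rewrite ?Sl ?subn0.
Qed.

Lemma admissibleW (l r : nat) (S : {fset nat}) :
  admissible l r S -> admissible l.+1 r S.
Proof. by case=> r3 lS cS; split=> // j /lS; lia. Qed.

Lemma admissible_relabel (l r : nat) (S : {fset nat}) :
  0 < l -> admissible l r.+1 S -> admissible l.+1 r (l.+1 |` S)%fset.
Proof.
move=> l0 [r3 lS cS]; split=> [|j|]; first lia.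
  by rewrite in_fset1U => /orP[/eqP->|/lS]; lia.
by rewrite cardfsU1; case: (_ \notin _); lia.
Qed.

(** The identity (r+1) C(m+1, r+1) = (m+1) C(m, r) makes the prescribed number of relabelled
    occurrences integral, and Pascal's rule gives the number left unchanged. The coefficient
    survives because it depends only on r + |S|, which relabelling preserves. *)
Lemma split_step (n l : nat) (F : 'I_(n ^ 2) -> {mset {mset nat}}) :
  0 < l < n -> split_family l F ->
  exists F' : 'I_(n ^ 2) -> {mset {mset nat}}, split_family l.+1 F'.
Proof.
move=> /andP[l0 ln] [Fsplit F1 Fj Fset].
(* [m] is the multiplicity of 1 after relabelling; before it, the multiplicity is [m.+1]. *)
pose m := n - l.
have mE : n - l + 1 = m.+1 by rewrite addn1.
have m'E : n - l.+1 + 1 = m by rewrite /m; lia.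
pose tot (A : {mset nat}) := \sum_i F i A.
pose c (A : {mset nat}) := (A 1 * tot A) %/ m.+1.
have c_ones r S : admissible l r.+1 S ->
    r.+1 * tot (ones_set r.+1 S) = m.+1 * (a_coef r.+1 S * 'C(m, r)).
  move=> /Fset; rewrite /mu_set mE /tot => ->.
  by rewrite mulnCA -mul_bin_diag mulnCA.
have totE A : tot A = 0 \/ exists r S, admissible l r S /\ A = ones_set r S.
  have [/eqP->|] := boolP (tot A == 0); first by left.
  rewrite sum_nat_eq0 negb_forall => /existsP[i].
  by rewrite /= mset_neq0 => /Fsplit; right.
have [f [fF_f1 cf]] : exists f : 'I_(n ^ 2) -> {mset nat},
    (forall i, f i \in F i /\ 0 < f i 1) /\
    forall A : {mset nat}, #|[set i | f i == A]| = c A.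
  apply: (@balanced_choice _ _ F (fun A => A 1) c m.+1) => [//|i|A].
    by rewrite -mE -(F1 i).
  (* The quotient in [c] is exact: [tot A] vanishes unless [A] is a block, the weight vanishes if
     [A] has no 1, and [c_ones] covers the rest. *)
  rewrite /c -/(tot A) [RHS]mulnC divnK //.
  have [->|[[|r] [S [adm AE]]]] := totE A; first by rewrite muln0.
    by rewrite AE (ones_set_eq1 adm) mul0n.
  by rewrite AE (ones_set_eq1 adm) c_ones // dvdn_mulr.
have fF i : f i \in F i by have [] := fF_f1 i.
have f1 i : 0 < f i 1 by have [] := fF_f1 i.
pose F' i : {mset {mset nat}} := relabel_one l.+1 (f i) +` (F i `\ f i).
have sumF' i j : mu_elt F' i j + f i j = mu_elt F i j + relabel_one l.+1 (f i) j.
  have -> : mu_elt F' i j = relabel_one l.+1 (f i) j + \sum_(A <- F i `\ f i) A j.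
    by rewrite /mu_elt sum_msetD sum_msetn mul1n.
  have -> : mu_elt F i j = f i j + \sum_(A <- F i `\ f i) A j.
    by rewrite /mu_elt -{1}(msetB1K (fF i)) sum_msetD sum_msetn mul1n.
  by rewrite addnC addnA addnAC.
exists F'; split.
- move=> i A; rewrite in_mset1D => /orP[/eqP->|/(msubset_subset (msubD1set _ _))].
    have [[|r] [S [adm fE]]] := Fsplit _ _ (fF i).
      by have := f1 i; rewrite fE (ones_set_eq1 adm).
    exists r, (l.+1 |` S)%fset; rewrite fE relabel_ones_set //.
    by split=> //; apply: admissible_relabel.
  by move=> /Fsplit[r [S [/admissibleW adm ->]]]; exists r, S.
- move=> i; have := sumF' i 1; rewrite F1 relabel_oneE mE m'E.
  by have := f1 i; lia.
- move=> i j; have := sumF' i j; rewrite relabel_oneE.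
  have [->|jl] := eqVneq j l.+1; last by move=> eqj jl1; have := Fj i j; lia.
  have fl : f i l.+1 = 0.
    by have [r [S [adm ->]]] := Fsplit _ _ (fF i); apply: ones_set_gt adm.
  suff -> : mu_elt F i l.+1 = 0 by rewrite fl; lia.
  rewrite /mu_elt big_seq big1 // => A /Fsplit[r [S [adm ->]]].
  exact: ones_set_gt adm.
move=> r S adm; rewrite m'E.
(* Balance for one block: new occurrences plus those relabelled away equal old occurrences plus
   those created. *)
have sumF : mu_set F' r S + c (ones_set r S) =
    tot (ones_set r S) + #|[set i | relabel_one l.+1 (f i) == ones_set r S]|.
  rewrite -cf /mu_set /tot -!sum1dep_card.
  rewrite [X in _ + X = _]big_mkcond [X in _ = _ + X]big_mkcond -!big_split /=.
  apply: eq_bigr => i _; rewrite /F' mset1DE msetB1E ![ones_set r S == _]eq_sym.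
  have [<-|_] := eqVneq (f i) (ones_set r S).
    by have := fF i; rewrite in_mset; case: (_ == f i) => /=; lia.
  by rewrite subn0 addn0 addnC; case: (_ == _).
(* Without [l.+1] in [S] no occurrence is created; with it none existed before, and all come from
   [ones_set r.+1 S']. *)
have [lS|lS] := boolP (l.+1 \in S); last first.
  have adm' : admissible l r S.
    case: adm => r3 jS cS; split=> // j Sj; have := jS j Sj.
    by have : j != l.+1 by [apply: contraNneq lS => <-]; lia.
  rewrite (_ : [set _ | _] = set0) ?cards0 in sumF; last first.
    apply/setP => i; rewrite !inE; apply: contraNF lS => /eqP/msetP/(_ l.+1).
    rewrite relabel_oneE ones_setE eqxx (_ : l.+1 == 1 = false); last by lia.
    by case: (_ \in S).
  have totS : tot (ones_set r S) = a_coef r S * 'C(m.+1, r) by rewrite -mE; apply: Fset.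
  move: sumF; rewrite /c (ones_set_eq1 adm) addn0.
  case: r => [|r] in adm adm' totS *.
    by rewrite mul0n div0n addn0 totS !bin0.
  by rewrite c_ones // mulKn // totS binS mulnDr => /addIn.
have [S' SE lS'] : exists2 S' : {fset nat}, S = (l.+1 |` S')%fset & l.+1 \notin S'.
  by exists (S `\ l.+1)%fset; rewrite ?fsetD1K // !inE eqxx.
have cS : #|` S| = #|` S'|.+1 by rewrite SE cardfsU1 lS'.
have adm' : admissible l r.+1 S'.
  case: adm => r3 jS cS3; split; [lia| |lia] => j Sj.
  have := jS j; rewrite SE in_fset1U Sj orbT => /(_ isT).
  by have : j != l.+1 by [apply: contraNneq lS' => <-]; lia.
have tot0 : tot (ones_set r S) = 0.
  have [//|[r0 [S0 [adm0 /msetP/(_ l.+1)]]]] := totE (ones_set r S).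
  by rewrite (ones_set_gt _ _ adm0) // ones_setE lS addn1.
rewrite tot0 /c tot0 muln0 div0n addn0 add0n in sumF; rewrite sumF.
rewrite (_ : [set _ | _] = [set i | f i == ones_set r.+1 S']); last first.
  apply/setP => i; rewrite !inE SE -(relabel_ones_set l0 adm').
  apply/eqP/eqP => [eqR|->//].
  rewrite -(relabel_oneK l.+1 (f1 i)) eqR relabel_oneK //.
  by rewrite (ones_set_eq1 adm').
rewrite cf /c (ones_set_eq1 adm') c_ones // mulKn //.
by rewrite /a_coef cS addnS addSn.
Qed.

(** * The base case: partitions of n into parts of size at most 3 *)

Lemma sum_nseq (T : Type) (k : nat) (a : T) (h : T -> nat) :
  \sum_(t <- nseq k a) h t = k * h a.
Proof. by rewrite big_nseq iter_addn_0 mulnC. Qed.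

(* A triple (x, y, z) stands for x blocks {1}, y blocks {1, 1} and z blocks
   {1, 1, 1}.  The case n = 3 fails: there every triple has y <= 1, so a total
   of 9 over 9 triples leaves no room for a triple with z > 0. *)
Lemma block_counts (n : nat) :
  0 < n -> n <> 3 -> n = 0 %[mod 3] \/ n = 2 %[mod 3] ->
  exists s : seq (nat * nat * nat), [/\ size s = n ^ 2,
    forall t, t \in s -> t.1.1 + 2 * t.1.2 + 3 * t.2 = n,
    \sum_(t <- s) t.1.1 = n & 2 * \sum_(t <- s) t.1.2 = 3 * (n * n.-1)].
Proof.
move=> n0 n3 nmod; rewrite -mulnn.
have [->|n2] := eqVneq n 2.
  exists [:: (2, 0, 0); (0, 1, 0); (0, 1, 0); (0, 1, 0)].
  split; rewrite ?unlock // => t.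
  by rewrite !inE => /or4P[] /eqP->.
(* The fact [0 < q] matters for n = 5: there [k - 2] truncates, but the middle list is empty. *)
have mem_cat3 (p q r : nat) (u v w t : nat * nat * nat) :
    t \in nseq p u ++ nseq q v ++ nseq r w ->
    [\/ t = u, 0 < q /\ t = v | t = w].
  by rewrite !mem_cat !mem_nseq => /or3P[] /andP[? /eqP->];
    [constructor 1|constructor 2|constructor 3].
have half k : exists c, 2 * c = k * (k - 1).
  by exists 'C(k, 2); rewrite -mul_bin_diag bin1 subn1.
case: nmod => nmod.
  pose k := n %/ 3; have nE : n = 3 * k by rewrite /k; lia.
  have k2 : 1 < k by lia.
  have [d dE] := half k.
  (* The first [n] triples supply all the x; [c] then solves n + 3c = 3n(n-1)/2, with [d] standing
     for k(k-1)/2. *)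
  pose c := 9 * d + 2 * k.
  exists (nseq n (1, 1, k - 1) ++ nseq c (0, 3, k - 2) ++ nseq (n * n - n - c) (0, 0, k)).
  split.
  - by rewrite !size_cat !size_nseq; nia.
  - by move=> t /mem_cat3[->|[_ ->]|->] /=; lia.
  - by rewrite !big_cat /= !sum_nseq /=; lia.
  - by rewrite !big_cat /= !sum_nseq /=; nia.
pose k := n %/ 3; have nE : n = 3 * k + 2 by rewrite /k; lia.
have k1 : 0 < k by lia.
have [d dE] := half k.
(* Here [c] solves 2n + 4c + (n^2 - n - c) = 3n(n-1)/2. *)
pose c := 3 * d + (k - 1).
exists (nseq n (1, 2, k - 1) ++ nseq c (0, 4, k - 2) ++ nseq (n * n - n - c) (0, 1, k)).
split.
- by rewrite !size_cat !size_nseq; nia.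
- by move=> t /mem_cat3[->|[c0 ->]|->] /=; lia.
- by rewrite !big_cat /= !sum_nseq /=; lia.
- by rewrite !big_cat /= !sum_nseq /=; nia.
Qed.

Definition ones_blocks (t : nat * nat * nat) : {mset {mset nat}} :=
  msetn t.1.1 (ones_set 1 fset0) `+`
    (msetn t.1.2 (ones_set 2 fset0) `+` msetn t.2 (ones_set 3 fset0)).

Lemma ones_set0_eq (a b : nat) : (ones_set a fset0 == ones_set b fset0) = (a == b).
Proof. by apply/eqP/eqP => [/msetP/(_ 1)|->//]; rewrite !ones_setE eqxx !addn0. Qed.

Lemma msetn3E (K : choiceType) (x y z : nat) (a b c u : K) :
  (msetn x a `+` (msetn y b `+` msetn z c)) u =
  (u == a) * x + (u == b) * y + (u == c) * z.
Proof.
rewrite !msetE2 !msetnE addnA.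
by case: (u == a); case: (u == b); case: (u == c); rewrite ?mul1n.
Qed.

Lemma in_msetn3 (K : choiceType) (x y z : nat) (a b c u : K) :
  u \in msetn x a `+` (msetn y b `+` msetn z c) -> [\/ u = a, u = b | u = c].
Proof.
rewrite !in_msetD !in_msetn => /or3P[] /andP[_ /eqP->];
  by [constructor 1|constructor 2|constructor 3].
Qed.

Lemma sum_msetn3 (K : choiceType) (x y z : nat) (a b c : K) (h : K -> nat) :
  \sum_(u <- msetn x a `+` (msetn y b `+` msetn z c)) h u =
  x * h a + y * h b + z * h c.
Proof. by rewrite 2!sum_msetD 3!sum_msetn addnA. Qed.

(** For [l = 1] the set [S] is empty, so only the totals n, 3 C(n, 2) and 2 C(n, 3) of the three
    block sizes matter. *)
Lemma split_base (n : nat) :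
  0 < n -> n <> 3 -> n = 0 %[mod 3] \/ n = 2 %[mod 3] ->
  exists F : 'I_(n ^ 2) -> {mset {mset nat}}, split_family 1 F.
Proof.
move=> n0 n3 nmod; have [s [ss st sx sy]] := block_counts n0 n3 nmod.
pose t (i : 'I_(n ^ 2)) := nth (0, 0, 0) s i.
have sum_t h : \sum_i h (t i) = \sum_(u <- s) h u.
  by rewrite (big_nth (0, 0, 0)) ss big_mkord.
have lin a b c : \sum_(u <- s) (a * u.1.1 + b * u.1.2 + c * u.2) =
    a * \sum_(u <- s) u.1.1 + b * \sum_(u <- s) u.1.2 + c * \sum_(u <- s) u.2.
  by rewrite !big_split /= !big_distrr.
(* The third total is forced by the other two, since the n^2 triples have total size n^3. *)
have sz : 3 * \sum_(u <- s) u.2 = n * (n.-1 * n.-2).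
  have : \sum_(u <- s) (1 * u.1.1 + 2 * u.1.2 + 3 * u.2) = n ^ 2 * n.
    rewrite big_seq (eq_bigr (fun=> n)) => [|u]; last by rewrite mul1n; apply: st.
    by rewrite -big_seq big_const_seq count_predT ss iter_addn_0 mulnC.
  rewrite lin sx sy -mulnn; move: (\sum_(u <- s) u.2) => z; clear.
  case: n => [|[|p]] h; [lia|lia|].
  by apply: (@addnI (1 * p.+2 + 3 * (p.+2 * p.+1))); rewrite h /=; ring.
exists (fun i => ones_blocks (t i)); split.
- move=> i A /in_msetn3[] ->.
  + by exists 1, fset0.
  + by exists 2, fset0.
  by exists 3, fset0.
- move=> i; rewrite /mu_elt sum_msetn3 !ones_setE eqxx !addn0.
  have /st : t i \in s by rewrite mem_nth ?ss.
  by case: (t i) => [[x y] z] /=; lia.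
- by move=> i j; lia.
move=> r S adm.
have -> : S = fset0.
  apply/fsetP => j; rewrite inE; apply: admissible_notin adm _; lia.
rewrite /mu_set.
under eq_bigr => i _ do rewrite msetn3E !ones_set0_eq.
rewrite (sum_t (fun u => (r == 1) * u.1.1 + (r == 2) * u.1.2 + (r == 3) * u.2)).
rewrite lin sx.
have b2 := mul_bin_diag n 1; have b3 := mul_bin_diag n 2.
have b2' := mul_bin_diag n.-1 1; rewrite !bin1 in b2 b2'.
rewrite b2' mulnCA b3 in sz; rewrite b2 in sy.
case: adm; rewrite /a_coef cardfs0 addn0.
case: r => [|[|[|[|//]]]] _ _ _; rewrite ?bin0 ?bin1 /= ?subnK //; lia.
Qed.

Theorem theorem4p1 (n : nat) (n_neq3 : n <> 3)
    (n_mod3 : n = 0 %[mod 3] \/ n = 2 %[mod 3])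
    (l : nat) (l_bounds : 1 <= l <= n) :
  exists F : 'I_(n ^ 2) -> {mset {mset nat}},
    [/\ forall i, is_split l (F i),
        forall i, mu_elt F i 1 = n - l + 1,
        forall i j, 2 <= j <= l -> mu_elt F i j = 1 &
        forall r S, admissible l r S ->
          mu_set F r S = a_coef r S * 'C(n - l + 1, r)].
Proof.
rewrite -[exists F, _]/(exists F : 'I_(n ^ 2) -> {mset {mset nat}}, split_family l F).
elim: l => [|[|l] IHl] in l_bounds *; first by [].
  by apply: split_base => //; lia.
have [F splitF] := IHl ltac:(lia).
by apply: (split_step _ splitF); lia.
Qed.
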